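(* Let $X$ be a nonempty set, let $A$ be a nonempty finite set, and let $F\colon A\to\mathcal P(X)$ be a soft set with $F(t)\neq\varnothing$ for every $t\in A$ and $\mathrm{SE}(F)\neq\varnothing$. Let $(F,\tau_1,\tau_2)$ be a soft bitopological space and let $H\subseteq_s F$. If for every $t\in A$ the set $H(t)$ is pairwise compact in the component bitopological space $(F(t),(\tau_1)_t,(\tau_2)_t)$, then $H$ is pairwise soft compact.
   Context: A soft set over $X$ with parameter set $A$ is a map $H\colon A\to\mathcal P(X)$; it is a soft subset of $F$, written $H\subseteq_s F$, if $H(t)\subseteq F(t)$ for every $t\in A$. Soft unions (arbitrary) and soft intersections (finite) are taken pointwise in $t$. The null soft set $\Phi$ is $\Phi(t)=\varnothing$ for all $t\in A$. $\mathrm{SE}(F)$ is the set of maps $a\colon A\to X$ with $a(t)\in F(t)$ for every $t\in A$. A soft topology on $F$ is a family $\tau$ of soft subsets of $F$ with $\Phi,F\in\tau$, closed under arbitrary soft unions and finite soft intersections. Its component topology at $t\in A$ is $\tau_t=\{H(t):H\in\tau\}$, which is a topology on $F(t)$. A soft bitopological space is a triple $(F,\tau_1,\tau_2)$ with $\tau_1,\tau_2$ soft topologies on $F$. For $H\subseteq_s F$, a pairwise soft open cover of $H$ is a family $\mathcal C\subseteq\tau_1\cup\tau_2$ with $H(t)\subseteq\bigcup_{C\in\mathcal C}C(t)$ for every $t\in A$. $H$ is pairwise soft compact if every pairwise soft open cover of $H$ has a finite subfamily that is still a pairwise soft open cover of $H$. For a bitopological space $(Y,\sigma_1,\sigma_2)$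 (two topologies on a set $Y$) and $B\subseteq Y$, a pairwise open cover of $B$ is a family $\mathcal V\subseteq\sigma_1\cup\sigma_2$ with $B\subseteq\bigcup_{V\in\mathcal V}V$ (it may consist only of sets from one of the topologies). $B$ is pairwise compact if every pairwise open cover of $B$ has a finite subfamily that covers $B$. *)

(* Defs.v *)
From mathcomp Require Import all_boot.
From mathcomp Require Import boolp classical_sets functions cardinality.

Set Implicit Arguments.
Unset Strict Implicit.
Unset Printing Implicit Defensive.

Local Open Scope classical_set_scope.

Section SoftSets.
Variables (A X : Type).

Definition soft_set := A -> set X.

Implicit Types (F G H : soft_set) (C tau : set soft_set).

Definition soft_subset H F : Prop := forall t, H t `<=` F t.

Definition soft_null : soft_set := fun=> set0.

Definition soft_bigcup C : soft_set := fun t => \bigcup_(G in C) G t.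

Definition soft_setI G H : soft_set := fun t => G t `&` H t.

Definition soft_elements F : set (A -> X) := [set a | forall t, F t (a t)].

Record soft_topology F tau : Prop := SoftTopology {
  soft_open_sub : forall G, tau G -> soft_subset G F;
  soft_open_null : tau soft_null;
  soft_open_full : tau F;
  soft_open_bigcup : forall C, C `<=` tau -> tau (soft_bigcup C);
  soft_openI : forall G H, tau G -> tau H -> tau (soft_setI G H) }.

Record soft_bitopological_space F : Type := SoftBitopologicalSpace {
  soft_open1 : set soft_set;
  soft_open2 : set soft_set;
  soft_open1_topology : soft_topology F soft_open1;
  soft_open2_topology : soft_topology F soft_open2 }.

Definition component tau (t : A) : set (set X) := [set G t | G in tau].

Definition pairwise_soft_open_cover F (S : soft_bitopological_space F) H C :
    Prop :=
  C `<=` soft_open1 S `|` soft_open2 S /\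
  forall t, H t `<=` \bigcup_(G in C) G t.

Definition pairwise_soft_compact F (S : soft_bitopological_space F) H : Prop :=
  forall C, pairwise_soft_open_cover S H C ->
  exists D, [/\ D `<=` C, finite_set D & pairwise_soft_open_cover S H D].

End SoftSets.

(* A topology on a subset Y of the type X is given by the family of its open
   sets, all of them seen as subsets of X. *)
Section Bitopology.
Variable X : Type.
Implicit Types (Y B : set X) (sigma V W : set (set X)).

Record topology_on Y sigma : Prop := TopologyOn {
  open_on_sub : forall U, sigma U -> U `<=` Y;
  open_on_set0 : sigma set0;
  open_on_full : sigma Y;
  open_on_bigcup : forall V, V `<=` sigma -> sigma (\bigcup_(U in V) U);
  open_onI : forall U1 U2, sigma U1 -> sigma U2 -> sigma (U1 `&` U2) }.

Record bitopological_space Y : Type := BitopologicalSpace {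
  open1 : set (set X);
  open2 : set (set X);
  open1_topology : topology_on Y open1;
  open2_topology : topology_on Y open2 }.

Definition pairwise_open_cover Y (S : bitopological_space Y) B V : Prop :=
  V `<=` open1 S `|` open2 S /\ B `<=` \bigcup_(U in V) U.

Definition pairwise_compact Y (S : bitopological_space Y) B : Prop :=
  forall V, pairwise_open_cover S B V ->
  exists W, [/\ W `<=` V, finite_set W & B `<=` \bigcup_(U in W) U].

End Bitopology.

Lemma component_topology (A X : Type) (F : soft_set A X)
    (tau : set (soft_set A X)) (t : A) :
  soft_topology F tau -> topology_on (F t) (component tau t).
Proof.
case=> tauS tau0 tauF tauU tauI; split.
- by move=> _ [G /tauS GF <-]; exact: GF.
- by exists (@soft_null A X).
- by exists F.
- move=> V Vtau; exists (soft_bigcup [set G | tau G /\ V (G t)]).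
    by apply: tauU => G [].
  apply/seteqP; split=> x.
    by move=> [G [_ VG] Gx]; exists (G t).
  move=> [U VU Ux]; have [G tauG GU] := Vtau _ VU.
  by exists G; [split=> //; rewrite GU | rewrite GU].
- move=> _ _ [G tauG <-] [H tauH <-].
  by exists (soft_setI G H) => //; exact: tauI.
Qed.

Definition component_space (A X : Type) (F : soft_set A X)
    (S : soft_bitopological_space F) (t : A) : bitopological_space (F t) :=
  BitopologicalSpace (component_topology t (soft_open1_topology S))
                     (component_topology t (soft_open2_topology S)).

(* Main.v *)
Require Import Defs.
From mathcomp Require Import all_boot.
From mathcomp Require Import boolp classical_sets functions cardinality.

Set Implicit Arguments.
Unset Strict Implicit.
Unset Printing Implicit Defensive.

Local Open Scope classical_set_scope.

(** Compactness is checked one parameter at a time. Evaluating a pairwise soft open cover [C] of [H]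
    at [t] gives a pairwise open cover of [H t] in the component space; a finite subcover there
    comes from finitely many members of [C] ([component_finite_subcover]). As [A] is finite, the
    union over [t] of these finite subfamilies is finite, and it covers [H] at every parameter. *)

(** The full preimage of [W] in [C] may be infinite, since [f] need not be injective, so a single
    preimage is chosen for each member of [W]. *)
Lemma finite_subset_image_lift (T U : Type) (f : T -> U) (C : set T)
    (W : set U) :
  finite_set W -> W `<=` f @` C ->
  exists D, [/\ D `<=` C, finite_set D & f @` D = W].
Proof.
move=> finW WC.
(* The choice function [g] must be total on [U]; a nonempty [W] supplies the default value [x0]
   outside [W]. *)
have [->|/set0P [u0 Wu0]] := eqVneq W set0.
  by exists set0; split=> //; rewrite image_set0.
have [x0 _ _] := WC _ Wu0.
have /choice [g gP] : forall u, exists x, W u -> C x /\ f x = u.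
  move=> u; have [/WC [x Cx fx]|nWu] := pselect (W u); first by exists x.
  by exists x0.
exists (g @` W); split.
- by move=> _ [u Wu <-]; have [] := gP u Wu.
- exact: finite_image.
- apply/seteqP; split=> [_ [_ [u Wu <-] <-]|u Wu].
    by have [_ ->] := gP u Wu.
  by exists (g u); [exists u | have [] := gP u Wu].
Qed.

(** Pairwise compactness yields finitely many open sets of the component space, whereas the soft
    cover needs members of [C]; the lifting lemma, applied to evaluation at [t], bridges the two. *)
Lemma component_finite_subcover (A X : Type) (F : soft_set A X)
    (S : soft_bitopological_space F) (H : soft_set A X)
    (C : set (soft_set A X)) (t : A) :
  pairwise_compact (component_space S t) (H t) ->
  pairwise_soft_open_cover S H C ->
  exists D, [/\ D `<=` C, finite_set D & H t `<=` \bigcup_(G in D) G t].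
Proof.
move=> cptHt [Copen Ccov].
have [|W [WC finW Wcov]] := cptHt ((fun G : soft_set A X => G t) @` C).
  split=> [_ [G CG <-]|x /Ccov [G CG Gx]]; last by exists (G t) => //; exists G.
  by have [oG|oG] := Copen G CG; [left|right]; exists G.
have [D [DC finD DW]] := finite_subset_image_lift finW WC.
exists D; split=> // x /Wcov; rewrite -DW => -[_ [G DG <-] Gx].
by exists G.
Qed.

Theorem theorem5p4 (X : Type) (A : finType) (F : soft_set A X)
  (S : soft_bitopological_space F) (H : soft_set A X)
  (X_neq0 : [set: X] !=set0) (A_neq0 : [set: A] !=set0)
  (F_neq0 : forall t : A, F t !=set0)
  (SE_neq0 : soft_elements F !=set0)
  (HF : soft_subset H F) :
  (forall t : A, pairwise_compact (component_space S t) (H t)) ->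
  pairwise_soft_compact S H.
Proof.
move=> cptH C Ccover.
have /choice [D DP] := fun t => component_finite_subcover (cptH t) Ccover.
have DC : \bigcup_t D t `<=` C.
  by move=> G [t _]; have [DtC _ _] := DP t; exact: DtC.
exists (\bigcup_t D t); split=> //.
  (* Finiteness of [A] enters here: a union of finite families indexed by a finite set is finite. *)
  by apply: bigcup_finite => [|t _]; [exact: finite_finset | have [] := DP t].
split; first exact: subset_trans DC Ccover.1.
move=> t x; have [_ _ Dcov] := DP t.
by move=> /Dcov [G DG Gx]; exists G => //; exists t.
Qed.
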